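(* Let $n\ge 1$ and $\epsilon\in(0,1]$. Consider the following testing problem: given access to independent copies of two unknown $n$-qubit mixed states $\rho$ and $\sigma$ (density matrices on $\mathbb{C}^{2^n}$), promised that either $\rho=\sigma$ or $\|\rho-\sigma\|_1>\epsilon$, decide which case holds, with success probability at least $2/3$ in each case. If each copy may only be measured individually by a two-outcome Pauli measurement, then the minimal total number of copies of $\rho$ and $\sigma$ needed is $\Theta\!\left(\mathrm{poly}(n)\cdot\frac{4^n}{\epsilon^2}\right)$. More precisely, there is a tester using $O\!\left(\frac{n^4\cdot 4^n}{\epsilon^2}\right)$ copies, and every such tester (even one that chooses its Pauli measurements adaptively) needs $\Omega\!\left(\frac{4^n}{\epsilon^2}\right)$ copies. *)

(* Defs.v *)
From HB Require Import structures.
From mathcomp Require Import all_boot all_order all_algebra.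
From mathcomp Require Import complex spectral.
From mathcomp Require Import reals.
Set Implicit Arguments. Unset Strict Implicit. Unset Printing Implicit Defensive.
Import Order.TTheory GRing.Theory Num.Theory.
Local Open Scope ring_scope.

Definition adjmx (C : numClosedFieldType) (N : nat) (A : 'M[C]_N) : 'M[C]_N :=
  map_mx Num.conj (A^T).

Definition density (C : numClosedFieldType) (N : nat) (rho : 'M[C]_N) : Prop :=
  [/\ adjmx rho = rho,
      (forall v : 'rV[C]_N, 0 <= (v *m rho *m map_mx Num.conj (v^T)) 0 0)
    & \tr rho = 1].

(** Trace norm ||A||_1 = tr sqrt(A^dagger A) = sum of the square roots of the
    eigenvalues of the (Hermitian, PSD) matrix A^dagger A, read off its spectral
    decomposition. *)
Definition trnorm (C : numClosedFieldType) (N : nat) (A : 'M[C]_N) : C :=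
  \sum_(i < N) sqrtC (spectral_diag (adjmx A *m A) 0 i).

(** Single-qubit Pauli matrices, index 0 = I, 1 = X, 2 = Y, 3 = Z;
    entries indexed by bits (false = |0>, true = |1>). *)
Definition pauli1 (C : numClosedFieldType) (a : 'I_4) (r c : bool) : C :=
  match nat_of_ord a with
  | 0 => if r == c then 1 else 0
  | 1 => if r == c then 0 else 1
  | 2 => if r == c then 0 else (if r then 'i else - 'i)
  | _ => if r == c then (if r then -1 else 1) else 0
  end.

(** k-th bit of a basis index of (C^2)^{tensor n} = C^(2^n). *)
Definition bitk (n : nat) (k : 'I_n) (i : 'I_(2 ^ n)) : bool := odd (i %/ 2 ^ k).

(** n-qubit Pauli string P_{s_1} tensor ... tensor P_{s_n}. *)
Definition pauli (C : numClosedFieldType) (n : nat) (s : {ffun 'I_n -> 'I_4})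
  : 'M[C]_(2 ^ n) :=
  \matrix_(i, j) \prod_(k < n) pauli1 C (s k) (bitk k i) (bitk k j).

(** One measurement action: which unknown state a fresh copy is taken from
    (true = rho, false = sigma) and which Pauli string is measured. *)
Definition action (n : nat) : Type := (bool * {ffun 'I_n -> 'I_4})%type.
Definition history (n : nat) : Type := seq (action n * bool).

(** Probability of outcome b (true = +1, false = -1) when measuring the
    two-outcome Pauli measurement {(I + P)/2, (I - P)/2} on state rho. *)
Definition outcomeProb (R : realType) (n : nat) (rho : 'M[R[i]]_(2 ^ n))
  (s : {ffun 'I_n -> 'I_4}) (b : bool) : R :=
  complex.Re (\tr (((2%:R)^-1 *: (1%:M + (if b then 1 else -1) *: pauli R[i] s)) *m rho)).

(** A (randomized, adaptive) tester: given the history of actions and outcomes,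
    a probability distribution over the next action, and finally a probability
    of answering "rho = sigma". *)
Record tester (R : realType) (n : nat) := Tester {
  t_choose : history n -> action n -> R;
  t_accept : history n -> R }.

Definition valid_tester (R : realType) (n : nat) (T : tester R n) : Prop :=
  (forall h a, 0 <= t_choose T h a) /\
  (forall h, \sum_(a : action n) t_choose T h a = 1) /\
  (forall h, 0 <= t_accept T h <= 1).

Fixpoint accProb (R : realType) (n : nat) (T : tester R n)
  (rho sigma : 'M[R[i]]_(2 ^ n)) (k : nat) (h : history n) : R :=
  match k with
  | 0 => t_accept T h
  | k'.+1 => \sum_(a : action n) t_choose T h a *
       \sum_(b : bool) outcomeProb (if a.1 then rho else sigma) a.2 b *
                       accProb T rho sigma k' (rcons h (a, b))
  end.

Definition solves (R : realType) (n : nat) (eps : R) (m : nat) (T : tester R n) : Prop :=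
  forall rho sigma : 'M[R[i]]_(2 ^ n), density rho -> density sigma ->
    (rho = sigma -> 2%:R / 3%:R <= accProb T rho sigma m [::]) /\
    (((eps%:C)%C < trnorm (rho - sigma)) -> accProb T rho sigma m [::] <= 1 / 3%:R).

(* Main.v *)
Require Import Defs.
From HB Require Import structures.
From mathcomp Require Import all_boot all_order all_algebra.
From mathcomp Require Import complex.
From mathcomp Require Import reals.
From mathcomp Require Import spectral sesquilinear.
From mathcomp Require Import sequences exp.
From mathcomp Require Import ring lra.
Set Implicit Arguments. Unset Strict Implicit. Unset Printing Implicit Defensive.
Import Order.TTheory GRing.Theory Num.Theory.
Local Open Scope ring_scope.

(** A Pauli measurement of [s] is a [+-1] coin whose mean is the coefficient
    [tr (P_s rho)], so the tester sees the two states only through these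
    [4 ^ n] coefficients.

    Upper bound.  By Cauchy-Schwarz and Parseval, [||rho - sigma||_1 > eps]
    forces the squared coefficient differences to sum to more than [eps ^ 2],
    i.e. to average more than [mu = eps ^ 2 / 4 ^ n].  By dyadic pigeonholing
    there is a scale [j <= 2 n] at which a fraction at least [1 / (6 n 2 ^ j)]
    of the Pauli strings has squared difference at least [2 ^ j mu / 2].  For
    every [j] one tries [24 n 2 ^ j] random strings, and spends
    [O(n ^ 2 / (2 ^ j mu))] copies on each: [4 n] independent second-moment
    tests, all of which must detect a difference.  Requiring unanimity makes
    false alarms exponentially rare, so that Chebyshev's inequality suffices.

    Lower bound.  Under [rho = sigma = I / 2 ^ n] some string [s <> I] is
    measured at most [m / (4 ^ n - 1)] times in expectation.  Replace the states
    by [(I +- e P_s) / 2 ^ n] with [e = 2 eps / 3]: the likelihood ratio is a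
    product of factors [1 +- e], bounded below by [exp (S - 3 e ^ 2 N)] and so by
    [1 + S - 3 e ^ 2 N], with [N] the number of measurements of [s] and [S] a
    martingale of variance [e ^ 2 E N].  The acceptance probability hence drops
    by [1 / 3] only if [e ^ 2 E N] is bounded below by a constant. *)

(** * Pauli strings *)

Lemma eq_of_bits (n a b : nat) : (a < 2 ^ n)%N -> (b < 2 ^ n)%N ->
  (forall k, (k < n)%N -> odd (a %/ 2 ^ k) = odd (b %/ 2 ^ k)) -> a = b.
Proof.
elim: n a b => [|n IH] a b; first by rewrite expn0 !ltnS !leqn0 => /eqP -> /eqP ->.
move=> ha hb hk.
rewrite -(odd_double_half a) -(odd_double_half b).
have -> : odd a = odd b by have := hk 0%N isT; rewrite expn0 !divn1.
congr (_ + _.*2)%N; apply: IH.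
- by rewrite -divn2 ltn_divLR // mulnC -expnS.
- by rewrite -divn2 ltn_divLR // mulnC -expnS.
- by move=> k kn; rewrite -!divn2 -!divnMA -expnS; apply: hk.
Qed.

Definition bits (n : nat) (i : 'I_(2 ^ n)) : {ffun 'I_n -> bool} :=
  [ffun k => bitk k i].

Lemma bits_inj (n : nat) : injective (@bits n).
Proof.
move=> i j /ffunP eqb; apply/ord_inj/(@eq_of_bits n); try exact: ltn_ord.
move=> k kn.
by have := eqb (Ordinal kn); rewrite !ffunE.
Qed.

Lemma bits_bij (n : nat) : bijective (@bits n).
Proof.
apply: inj_card_bij; first exact: bits_inj.
by rewrite card_ffun card_bool !card_ord.
Qed.

(** Bits identify basis indices with all Boolean functions on the qubits, so distributivity applies.
    This reduces each [n]-qubit identity below to a [2]-by-[2] check. *)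
Lemma sum_prod_bitk (C : comNzRingType) (n : nat) (G : 'I_n -> bool -> C) :
  \sum_(i < 2 ^ n) \prod_(k < n) G k (bitk k i) = \prod_(k < n) \sum_b G k b.
Proof.
rewrite bigA_distr_bigA /= (reindex (@bits n)) /=; last exact/onW_bij/bits_bij.
by apply: eq_bigr => i _; apply: eq_bigr => k _; rewrite ffunE.
Qed.

Lemma prod_eq_bitk (C : comNzRingType) (n : nat) (i j : 'I_(2 ^ n)) :
  \prod_(k < n) (bitk k i == bitk k j)%:R = (i == j)%:R :> C.
Proof.
have [->|neq] := eqVneq i j; first by rewrite big1 // => k _; rewrite eqxx.
have [k neqk] : exists k, bitk k i != bitk k j.
  apply/existsP; apply: contraNT neq => /existsPn H; apply/eqP/bits_inj.
  by apply/ffunP => k; rewrite !ffunE; apply/eqP; have := H k; rewrite negbK.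
by rewrite (bigD1 k) //= (negPf neqk) mul0r.
Qed.

Lemma pauli1_conj (C : numClosedFieldType) (a : 'I_4) (r c : bool) :
  (pauli1 C a r c)^* = pauli1 C a c r.
Proof.
by case: a => -[|[|[|[|a]]]] lt_a //; case: r; case: c;
  rewrite /pauli1 /= ?rmorphN /= ?conjC0 ?conjC1 ?conjCi ?opprK.
Qed.

Lemma pauli1_sqr (C : numClosedFieldType) (a : 'I_4) (r c : bool) :
  \sum_b pauli1 C a r b * pauli1 C a b c = (r == c)%:R.
Proof.
rewrite big_bool; case: a => -[|[|[|[|a]]]] lt_a //; case: r; case: c;
  rewrite /pauli1 /= ?(mulr0, mul0r, addr0, add0r, mulr1, mulrN, mulNr, opprK) //;
  by rewrite -expr2 sqrCi opprK.
Qed.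

Lemma pauli1_ortho (C : numClosedFieldType) (a b : 'I_4) :
  \sum_r \sum_c pauli1 C a r c * pauli1 C b c r = (2 * (a == b))%:R.
Proof.
rewrite !big_bool /=; case: a => -[|[|[|[|a]]]] lt_a //; case: b => -[|[|[|[|b]]]] lt_b //;
  rewrite /pauli1 /= ?(mulr0, mul0r, addr0, add0r, mulr1, mul1r, mulrN, mulNr, opprK) //
    -?expr2 ?sqrCi; ring.
Qed.

Lemma pauli1_complete (C : numClosedFieldType) (r c r' c' : bool) :
  \sum_(a < 4) pauli1 C a r c * (pauli1 C a r' c')^*
    = (2 * ((r == r') && (c == c')))%:R.
Proof.
rewrite !big_ord_recl big_ord0 /pauli1 /=.
case: r; case: c; case: r'; case: c' => /=;
  rewrite ?rmorphN /= ?conjC0 ?conjC1 ?conjCi ?opprK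
    ?(mulr0, mul0r, addr0, add0r, mulr1, mul1r, mulrN, mulNr, opprK) //
    -?expr2 ?sqrCi; ring.
Qed.

Lemma adjmx_pauli (C : numClosedFieldType) (n : nat) (s : {ffun 'I_n -> 'I_4}) :
  adjmx (pauli C s) = pauli C s.
Proof.
apply/matrixP => i j; rewrite !mxE rmorph_prod; apply: eq_bigr => k _.
exact: pauli1_conj.
Qed.

Lemma pauli_sqr (C : numClosedFieldType) (n : nat) (s : {ffun 'I_n -> 'I_4}) :
  pauli C s *m pauli C s = 1%:M.
Proof.
apply/matrixP => i j; rewrite !mxE.
under eq_bigr => l _ do rewrite !mxE -big_split /=.
rewrite (sum_prod_bitk (fun k b => pauli1 C (s k) (bitk k i) b * pauli1 C (s k) b (bitk k j))).
by under eq_bigr => k _ do rewrite pauli1_sqr; rewrite prod_eq_bitk.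
Qed.

Lemma mxtrace_pauliM (C : numClosedFieldType) (n : nat) (s t : {ffun 'I_n -> 'I_4}) :
  \tr (pauli C s *m pauli C t) = (2 ^ n * (s == t))%:R.
Proof.
have -> : \tr (pauli C s *m pauli C t) = \prod_(k < n) (2 * (s k == t k))%:R.
  transitivity (\sum_i \sum_j \prod_(k < n)
      (pauli1 C (s k) (bitk k i) (bitk k j) * pauli1 C (t k) (bitk k j) (bitk k i))).
    apply: eq_bigr => i _; rewrite !mxE; apply: eq_bigr => j _.
    by rewrite !mxE big_split.
  under eq_bigr => i _ do rewrite
    (sum_prod_bitk (fun k b => pauli1 C (s k) (bitk k i) b * pauli1 C (t k) b (bitk k i))).
  rewrite (sum_prod_bitk (fun k r => \sum_b pauli1 C (s k) r b * pauli1 C (t k) b r)).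
  by apply: eq_bigr => k _; rewrite pauli1_ortho.
have [->|neq] := eqVneq s t.
  under eq_bigr => k _ do rewrite eqxx muln1.
  by rewrite prodr_const card_ord muln1 natrX.
have [k neqk] : exists k, s k != t k.
  apply/existsP; apply: contraNT neq => /existsPn H; apply/eqP/ffunP => k.
  by apply/eqP; have := H k; rewrite negbK.
by rewrite (bigD1 k) //= (negPf neqk) !muln0 mul0r.
Qed.

Definition pauli_id (n : nat) : {ffun 'I_n -> 'I_4} := [ffun => ord0].

Lemma pauli_idE (C : numClosedFieldType) (n : nat) : pauli C (pauli_id n) = 1%:M.
Proof.
apply/matrixP => i j; rewrite !mxE -prod_eq_bitk.
by apply: eq_bigr => k _; rewrite ffunE /pauli1 /=; case: eqP.
Qed.

Lemma mxtrace_pauli (C : numClosedFieldType) (n : nat) (s : {ffun 'I_n -> 'I_4}) :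
  \tr (pauli C s) = (2 ^ n * (s == pauli_id n))%:R.
Proof. by rewrite -mxtrace_pauliM pauli_idE mulmx1. Qed.

Lemma pauli_complete (C : numClosedFieldType) (n : nat) (i j i' j' : 'I_(2 ^ n)) :
  \sum_s pauli C s i j * (pauli C s i' j')^*
    = (2 ^ n * ((i == i') && (j == j')))%:R.
Proof.
under eq_bigr => s _ do rewrite !mxE rmorph_prod -big_split /=.
rewrite -(bigA_distr_bigA (fun (k : 'I_n) a => pauli1 C a (bitk k i) (bitk k j) *
  (pauli1 C a (bitk k i') (bitk k j'))^*)) /=.
under eq_bigr => k _ do rewrite pauli1_complete -mulnb !natrM.
by rewrite !big_split /= !prod_eq_bitk prodr_const card_ord -mulnb !natrM natrX.
Qed.

(** Once both traces are expanded into entries and the sum over [s] is moved innermost,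
    [pauli_complete] leaves only the terms [i' = i], [j' = j]. *)
Lemma pauli_parseval (C : numClosedFieldType) (n : nat) (A : 'M[C]_(2 ^ n)) :
  \sum_s `|\tr (pauli C s *m A)| ^+ 2 = (2 ^ n)%:R * \tr (adjmx A *m A).
Proof.
transitivity (\sum_s \sum_i \sum_j \sum_i' \sum_j'
   (A j i * (A j' i')^*) * (pauli C s i j * (pauli C s i' j')^*)).
  apply: eq_bigr => s _; rewrite normCK /mxtrace rmorph_sum mulr_suml.
  apply: eq_bigr => i _; rewrite [(pauli C s *m A) i i]mxE mulr_suml.
  apply: eq_bigr => j _; rewrite mulr_sumr; apply: eq_bigr => i' _.
  rewrite [(pauli C s *m A) i' i']mxE rmorph_sum mulr_sumr; apply: eq_bigr => j' _.
  by rewrite rmorphM; ring.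
rewrite exchange_big mulr_sumr; apply: eq_bigr => i _.
rewrite exchange_big [(adjmx A *m A) i i]mxE mulr_sumr; apply: eq_bigr => j _.
rewrite exchange_big (bigD1 i) //= [X in _ + X]big1 ?addr0; last first.
  move=> i' neq; rewrite exchange_big big1 // => j' _.
  by rewrite -mulr_sumr pauli_complete eq_sym (negPf neq) muln0 mulr0.
rewrite exchange_big (bigD1 j) //= [X in _ + X]big1 ?addr0; last first.
  by move=> j' neq; rewrite -mulr_sumr pauli_complete [j == j']eq_sym (negPf neq) andbF muln0 mulr0.
by rewrite -mulr_sumr pauli_complete !eqxx muln1 !mxE; ring.
Qed.

(** * Trace norm and measurement statistics *)

(** Cauchy-Schwarz against the constant vector, from [x i * x j <= (x i ^+ 2 + x j ^+ 2) / 2]. *)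
Lemma sqr_sum_le_card (C : numFieldType) (N : nat) (x : 'I_N -> C) :
  (forall i, x i \is Num.real) ->
  (\sum_i x i) ^+ 2 <= N%:R * \sum_i x i ^+ 2.
Proof.
move=> xr; have xy_le i j : x i * x j <= (x i ^+ 2 + x j ^+ 2) / 2.
  have : 0 <= (x i - x j) ^+ 2 by rewrite real_exprn_even_ge0 ?rpredB.
  rewrite sqrrB => h; rewrite ler_pdivlMr //.
  by rewrite -subr_ge0; move: h; congr (0 <= _); ring.
have -> : N%:R * \sum_i x i ^+ 2 = \sum_i \sum_j (x i ^+ 2 + x j ^+ 2) / 2.
  transitivity (\sum_(i < N) (N%:R * x i ^+ 2 / 2 + (\sum_j x j ^+ 2) / 2)).
    rewrite big_split /= -!mulr_suml -mulr_sumr sumr_const card_ord -mulr_natl.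
    by set S := \sum_i _; field.
  apply: eq_bigr => i _; rewrite -mulr_suml big_split /= sumr_const card_ord mulrDl.
  by rewrite mulr_natl.
rewrite expr2 mulr_suml; apply: ler_sum => i _; rewrite mulr_sumr.
exact: ler_sum.
Qed.

Lemma adjmxM (C : numClosedFieldType) (N : nat) (A B : 'M[C]_N) :
  adjmx (A *m B) = adjmx B *m adjmx A.
Proof. by rewrite /adjmx trmx_mul map_mxM. Qed.

Lemma adjmxK (C : numClosedFieldType) (N : nat) (A : 'M[C]_N) : adjmx (adjmx A) = A.
Proof. by apply/matrixP => i j; rewrite !mxE conjCK. Qed.

Lemma adjmxE (C : numClosedFieldType) (N : nat) (A : 'M[C]_N) :
  adjmx A = (A ^t Num.conj)%sesqui.
Proof. by apply/matrixP => i j; rewrite !mxE. Qed.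

Lemma gram_normal (C : numClosedFieldType) (N : nat) (A : 'M[C]_N) :
  adjmx A *m A \is normalmx.
Proof. by apply/normalmxP; rewrite -!adjmxE adjmxM adjmxK. Qed.

Lemma mulmx_adj_diag_ge0 (C : numClosedFieldType) (N : nat) (X : 'M[C]_N) i :
  0 <= (X *m adjmx X) i i.
Proof. by rewrite mxE sumr_ge0 // => k _; rewrite !mxE mul_conjC_ge0. Qed.

Lemma gram_spectral (C : numClosedFieldType) (N : nat) (A : 'M[C]_N) :
  let U := spectralmx (adjmx A *m A) in
  U *m (adjmx A *m A) *m adjmx U = diag_mx (spectral_diag (adjmx A *m A)).
Proof.
set B := adjmx A *m A => U.
have /orthomx_spectralP EB := gram_normal A; rewrite -/B -/U in EB.
have uU : U \in unitmx by exact: spectral_unit.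
rewrite {1}EB adjmxE -invmx_unitary ?spectral_unitarymx //.
by rewrite !mulmxA mulmxV // mul1mx mulmxK.
Qed.

(** With [U] the diagonalizing unitary, the eigenvalues are the diagonal entries of [X *m adjmx X]
    for [X = U *m adjmx A]. *)
Lemma spectral_diag_gram_ge0 (C : numClosedFieldType) (N : nat) (A : 'M[C]_N) i :
  0 <= spectral_diag (adjmx A *m A) 0 i.
Proof.
have := mulmx_adj_diag_ge0 (spectralmx (adjmx A *m A) *m adjmx A) i.
by rewrite adjmxM adjmxK mulmxA -[_ *m A]mulmxA gram_spectral !mxE eqxx mulr1n.
Qed.

Lemma sum_spectral_diag_gram (C : numClosedFieldType) (N : nat) (A : 'M[C]_N) :
  \sum_i spectral_diag (adjmx A *m A) 0 i = \tr (adjmx A *m A).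
Proof.
rewrite -mxtrace_diag -gram_spectral mxtrace_mulC.
rewrite [adjmx (spectralmx _)]adjmxE -invmx_unitary ?spectral_unitarymx // mulKmx //.
exact: spectral_unit.
Qed.

(** Cauchy-Schwarz over the [N] singular values, whose squares sum to the trace of the Gram
    matrix. *)
Lemma trnorm_sqr_le (C : numClosedFieldType) (N : nat) (A : 'M[C]_N) :
  trnorm A ^+ 2 <= N%:R * \tr (adjmx A *m A).
Proof.
have ge0 i : 0 <= sqrtC (spectral_diag (adjmx A *m A) 0 i).
  by rewrite sqrtC_ge0 spectral_diag_gram_ge0.
apply: le_trans (sqr_sum_le_card (fun i => ger0_real (ge0 i))) _.
by under eq_bigr => i _ do rewrite sqrtCK; rewrite sum_spectral_diag_gram.
Qed.

(** A scalar Gram matrix is unchanged by unitary conjugation, so every singular value is [c]. This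
    evaluates exactly the distance of the pair used in the lower bound. *)
Lemma trnorm_scalar_gram (C : numClosedFieldType) (N : nat) (A : 'M[C]_N) (c : C) :
  0 <= c -> adjmx A *m A = (c ^+ 2)%:M -> trnorm A = N%:R * c.
Proof.
move=> c0 EA; have := gram_spectral A; rewrite /trnorm EA.
rewrite -scalemx1 -scalemxAr mulmx1 -scalemxAl adjmxE.
set U := spectralmx _; have /unitarymxP -> : U \is unitarymx.
  exact: spectral_unitarymx.
move=> Ed; rewrite (eq_bigr (fun => c)) => [|i _].
  by rewrite sumr_const card_ord mulr_natl.
have /matrixP/(_ i i) := Ed; rewrite !mxE eqxx !mulr1n mulr1 => <-.
by rewrite sqrCK.
Qed.

Lemma ReD (R : rcfType) (x y : R[i]) : complex.Re (x + y) = complex.Re x + complex.Re y.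
Proof. by case: x; case: y. Qed.

Lemma ReB (R : rcfType) (x y : R[i]) : complex.Re (x - y) = complex.Re x - complex.Re y.
Proof. by case: x; case: y. Qed.

Lemma ReZ (R : rcfType) (k : R) (x : R[i]) :
  complex.Re ((k%:C)%C * x) = k * complex.Re x.
Proof. by case: x => a b /=; rewrite mul0r subr0. Qed.

Definition expval (R : realType) (n : nat) (rho : 'M[R[i]]_(2 ^ n))
  (s : {ffun 'I_n -> 'I_4}) : R := complex.Re (\tr (pauli R[i] s *m rho)).

Definition sgb (R : realType) (b : bool) : R := if b then 1 else -1.

Lemma outcomeProbE (R : realType) (n : nat) (rho : 'M[R[i]]_(2 ^ n)) s b :
  \tr rho = 1 -> outcomeProb rho s b = (1 + sgb R b * expval rho s) / 2.
Proof.
move=> tr1; rewrite /outcomeProb /expval.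
rewrite -scalemxAl mulmxDl mul1mx -scalemxAl mxtraceZ mxtraceD mxtraceZ tr1.
set t := \tr _.
have -> : (2%:R : R[i])^-1 = ((2^-1 : R)%:C)%C by rewrite fmorphV rmorph_nat.
have -> : (if b then 1 else -1 : R[i]) = ((sgb R b)%:C)%C.
  by rewrite /sgb; case: b; rewrite ?rmorphN rmorph1.
by rewrite ReZ ReD ReZ mulrC.
Qed.

Lemma sum_outcomeProb (R : realType) (n : nat) (rho : 'M[R[i]]_(2 ^ n)) s :
  \tr rho = 1 -> \sum_b outcomeProb rho s b = 1.
Proof. by move=> tr1; rewrite big_bool !outcomeProbE // /sgb /=; field. Qed.

(** Each diagonal entry is the quadratic form of [rho] at a row of [X]. *)
Lemma mxtrace_sandwich_ge0 (C : numClosedFieldType) (N : nat) (X rho : 'M[C]_N) :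
  (forall v : 'rV[C]_N, 0 <= (v *m rho *m map_mx Num.conj (v^T)) 0 0) ->
  0 <= \tr (X *m rho *m adjmx X).
Proof.
move=> psd; apply: sumr_ge0 => i _; have := psd (row i X).
congr (0 <= _); rewrite -row_mul !mxE; apply: eq_bigr => k _.
by rewrite !mxE.
Qed.

Lemma adjmxD (C : numClosedFieldType) (N : nat) (A B : 'M[C]_N) :
  adjmx (A + B) = adjmx A + adjmx B.
Proof. by apply/matrixP => i j; rewrite !mxE rmorphD. Qed.

Lemma adjmxZ (C : numClosedFieldType) (N : nat) (c : C) (A : 'M[C]_N) :
  adjmx (c *: A) = c^* *: adjmx A.
Proof. by apply/matrixP => i j; rewrite !mxE rmorphM. Qed.

Lemma adjmx1 (C : numClosedFieldType) (N : nat) : adjmx (1%:M : 'M[C]_N) = 1%:M.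
Proof. by apply/matrixP => i j; rewrite !mxE eq_sym conjC_nat. Qed.

(** The measurement operator [X] is a self-adjoint projector, so the probability is the trace of
    [X *m rho *m adjmx X]. *)
Lemma outcomeProb_ge0 (R : realType) (n : nat) (rho : 'M[R[i]]_(2 ^ n)) s b :
  density rho -> 0 <= outcomeProb rho s b.
Proof.
move=> [_ psd _]; rewrite /outcomeProb.
set e : R[i] := if b then 1 else -1.
have ee : e * e = 1 by rewrite /e; case: (b); ring.
have ce : e^* = e by rewrite /e; case: (b); rewrite ?rmorphN /= conjC1.
set X := _ *: (1%:M + e *: pauli R[i] s).
have aX : adjmx X = X.
  by rewrite adjmxZ adjmxD adjmxZ adjmx1 adjmx_pauli ce fmorphV /= conjC_nat.
have XX : X *m X = X.
  rewrite -scalemxAl -scalemxAr scalerA mulmxDl !mulmxDr mul1mx mulmx1 mul1mx.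
  rewrite -scalemxAl -scalemxAr pauli_sqr scalerA ee scale1r.
  set Q := e *: _; have -> : 1%:M + Q + (Q + 1%:M) = 2%:R *: (1%:M + Q).
    by rewrite scaler_nat mulr2n [Q + 1%:M]addrC.
  by rewrite scalerA -mulrA mulVf ?pnatr_eq0 // mulr1.
have := mxtrace_sandwich_ge0 X psd.
by rewrite aX mxtrace_mulC mulmxA XX; case: (\tr _) => a c; rewrite lecE => /andP[].
Qed.

Lemma mxtrace_pauli_real (C : numClosedFieldType) (n : nat) (A : 'M[C]_(2 ^ n)) s :
  adjmx A = A -> \tr (pauli C s *m A) \is Num.real.
Proof.
move=> hA; rewrite CrealE; apply/eqP.
have -> : (\tr (pauli C s *m A))^* = \tr (adjmx (pauli C s *m A)).
  by rewrite rmorph_sum; apply: eq_bigr => i _; rewrite [RHS]mxE [_^T _ _]mxE.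
by rewrite adjmxM hA adjmx_pauli mxtrace_mulC.
Qed.

(** The dimension factor of [trnorm_sqr_le] is exactly the factor [2 ^ n] of Parseval, so no loss in
    the dimension remains. *)
Lemma trnorm_gt_sum_expval (R : realType) (n : nat) (eps : R)
    (rho sigma : 'M[R[i]]_(2 ^ n)) :
  0 < eps -> density rho -> density sigma -> (eps%:C)%C < trnorm (rho - sigma) ->
  eps ^+ 2 < \sum_s (expval rho s - expval sigma s) ^+ 2.
Proof.
move=> eps0 [hr _ _] [hs _ _] far; set A := rho - sigma.
have hA : adjmx A = A.
  by rewrite /A -scaleN1r adjmxD adjmxZ hr hs rmorphN /= conjC1.
rewrite -ltcR rmorphXn /=.
have : (eps%:C)%C ^+ 2 < trnorm A ^+ 2.
  by rewrite ltr_pXn2r // ?nnegrE ?(ltW (le_lt_trans _ far)) ?ler0c ?ltW.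
move/lt_le_trans; apply; apply: le_trans (trnorm_sqr_le A) _.
rewrite -pauli_parseval rmorph_sum /=; apply: ler_sum => s _.
rewrite /expval -ReB -linearB -mulmxBr -/A.
by rewrite rmorphXn /= RRe_real ?mxtrace_pauli_real // real_normK ?mxtrace_pauli_real.
Qed.

(** * Combining testers *)

Lemma convex_bounds (R : realType) (I : finType) (w f : I -> R) :
  (forall i, 0 <= w i) -> \sum_i w i = 1 -> (forall i, 0 <= f i <= 1) ->
  0 <= \sum_i w i * f i <= 1.
Proof.
move=> w0 w1 f01; apply/andP; split.
  by apply: sumr_ge0 => i _; rewrite mulr_ge0 //; case/andP: (f01 i).
rewrite -w1; apply: ler_sum => i _; rewrite ler_piMr //.
by case/andP: (f01 i).
Qed.

Lemma accProb_bounds (R : realType) (n : nat) (T : tester R n) rho sigma k h :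
  valid_tester T -> density rho -> density sigma ->
  0 <= accProb T rho sigma k h <= 1.
Proof.
move=> [T0 [T1 TA]] dr ds; elim: k h => [|k IH] h //=.
apply: convex_bounds => // a.
have da : density (if a.1 then rho else sigma) by case: a.1.
apply: convex_bounds => // [b|]; first exact: outcomeProb_ge0.
by apply: sum_outcomeProb; case: da.
Qed.

Definition complT (R : realType) (n : nat) (T : tester R n) : tester R n :=
  Tester (t_choose T) (fun h => 1 - t_accept T h).

Lemma valid_complT (R : realType) (n : nat) (T : tester R n) :
  valid_tester T -> valid_tester (complT T).
Proof.
move=> [T0 [T1 TA]]; split=> //; split=> // h /=.
by case/andP: (TA h) => h0 h1; rewrite subr_ge0 h1 lerBlDr lerDl.
Qed.

Lemma accProb_complT (R : realType) (n : nat) (T : tester R n) rho sigma k h :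
  valid_tester T -> density rho -> density sigma ->
  accProb (complT T) rho sigma k h = 1 - accProb T rho sigma k h.
Proof.
move=> [T0 [T1 TA]] dr ds; elim: k h => [|k IH] h //=.
rewrite -(T1 h) -sumrB; apply: eq_bigr => a _.
rewrite -[X in _ = X - _]mulr1 -mulrBr; congr (_ * _).
have da : \tr (if a.1 then rho else sigma) = 1 by case: a.1; [case: dr | case: ds].
rewrite -(sum_outcomeProb a.2 da) -sumrB; apply: eq_bigr => b _.
by rewrite IH mulrBr mulr1.
Qed.

(** Two independent runs: [T2] sees only its own part of the history, and acceptance requires both
    to accept, so acceptance probabilities multiply. *)
Definition seqT (R : realType) (n m : nat) (T1 T2 : tester R n) : tester R n :=
  Tester (fun h => if (size h < m)%N then t_choose T1 h else t_choose T2 (drop m h))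
         (fun h => t_accept T1 (take m h) * t_accept T2 (drop m h)).

Lemma valid_seqT (R : realType) (n m : nat) (T1 T2 : tester R n) :
  valid_tester T1 -> valid_tester T2 -> valid_tester (seqT m T1 T2).
Proof.
move=> [p1 [s1 a1]] [p2 [s2 a2]]; split; first by move=> h a /=; case: ifP.
split=> h /=; first by case: ifP.
case/andP: (a1 (take m h)) => x0 x1; case/andP: (a2 (drop m h)) => y0 y1.
by rewrite mulr_ge0 // mulr_ile1.
Qed.

Lemma accProb_seqT_tail (R : realType) (n m : nat) (T1 T2 : tester R n) rho sigma k h1 h2 :
  size h1 = m ->
  accProb (seqT m T1 T2) rho sigma k (h1 ++ h2)
    = t_accept T1 h1 * accProb T2 rho sigma k h2.
Proof.
move=> sz; elim: k h2 => [|k IH] h2 /=; first by rewrite take_size_cat // drop_size_cat.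
rewrite size_cat sz ltnNge leq_addr /= drop_size_cat // mulr_sumr.
apply: eq_bigr => a _; rewrite mulrCA; congr (_ * _); rewrite mulr_sumr.
by apply: eq_bigr => b _; rewrite rcons_cat IH mulrCA.
Qed.

Lemma accProb_seqT (R : realType) (n m1 m2 : nat) (T1 T2 : tester R n) rho sigma k h :
  (size h + k = m1)%N ->
  accProb (seqT m1 T1 T2) rho sigma (k + m2) h
    = accProb T1 rho sigma k h * accProb T2 rho sigma m2 [::].
Proof.
elim: k h => [|k IH] h sz.
  by rewrite -[in LHS](cats0 h) add0n accProb_seqT_tail //= -sz addn0.
rewrite addSn /= -sz addnS ltnS leq_addr mulr_suml.
apply: eq_bigr => a _; rewrite -mulrA; congr (_ * _); rewrite mulr_suml.
by apply: eq_bigr => b _; rewrite -addnS sz IH ?mulrA // size_rcons -sz addnS.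
Qed.

(** A uniformly random string is drawn by measuring it once on [rho]. The outcome is ignored; the
    recorded action tells the later steps which [Ts s] to run. This costs one extra copy. *)
Definition mixT (R : realType) (n : nat) (Ts : {ffun 'I_n -> 'I_4} -> tester R n) :
    tester R n :=
  Tester (fun h a => match h with
                     | [::] => if a.1 then (4%:R ^+ n)^-1 else 0
                     | x :: h' => t_choose (Ts x.1.2) h' a
                     end)
         (fun h => match h with
                   | [::] => 0
                   | x :: h' => t_accept (Ts x.1.2) h'
                   end).

Lemma sum_action (R : realType) (n : nat) (F : action n -> R) :
  \sum_a F a = \sum_s F (true, s) + \sum_s F (false, s).
Proof.
transitivity (\sum_b \sum_s F (b, s)); last by rewrite big_bool.
by rewrite pair_bigA; apply: eq_bigr => -[].
Qed.

Lemma card_pauli (n : nat) : #|{ffun 'I_n -> 'I_4}| = (4 ^ n)%N.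
Proof. by rewrite card_ffun !card_ord. Qed.

Lemma valid_mixT (R : realType) (n : nat) (Ts : {ffun 'I_n -> 'I_4} -> tester R n) :
  (forall s, valid_tester (Ts s)) -> valid_tester (mixT Ts).
Proof.
move=> vT; split; [|split].
- move=> [|x h] a /=; last by case: (vT x.1.2).
  by case: ifP => // _; rewrite invr_ge0 exprn_ge0.
- move=> [|x h] /=; last by case: (vT x.1.2) => _ [].
  rewrite sum_action /= [X in _ + X]big1 // addr0 sumr_const card_pauli.
  by rewrite -[_ *+ (4 ^ n)]mulr_natl natrX mulfV // expf_neq0 // pnatr_eq0.
- by move=> [|x h] /=; [rewrite lexx ler01 | case: (vT x.1.2) => _ []].
Qed.

Lemma accProb_mixT_tail (R : realType) (n : nat) (Ts : {ffun 'I_n -> 'I_4} -> tester R n)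
    rho sigma k x h :
  accProb (mixT Ts) rho sigma k (x :: h) = accProb (Ts x.1.2) rho sigma k h.
Proof.
elim: k h => [//|k IH] h /=; apply: eq_bigr => a _; congr (_ * _).
by apply: eq_bigr => b _; rewrite IH.
Qed.

Lemma accProb_mixT (R : realType) (n : nat) (Ts : {ffun 'I_n -> 'I_4} -> tester R n)
    rho sigma k :
  density rho -> accProb (mixT Ts) rho sigma k.+1 [::]
    = (4%:R ^+ n)^-1 * \sum_s accProb (Ts s) rho sigma k [::].
Proof.
move=> [_ _ tr1] /=; rewrite sum_action /= [X in _ + X]big1 ?addr0; last first.
  by move=> s _; rewrite mul0r.
rewrite mulr_sumr; apply: eq_bigr => s _; congr (_ * _).
under eq_bigr => b _ do rewrite accProb_mixT_tail /=.
by rewrite -mulr_suml sum_outcomeProb // mul1r.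
Qed.

(** Forgets the tester and keeps only its acceptance probability and copy count. The closure
    properties below (complement, product, power, average) then build the final tester without
    handling histories. *)
Definition realizable (R : realType) (n m : nat)
    (f : 'M[R[i]]_(2 ^ n) -> 'M[R[i]]_(2 ^ n) -> R) : Prop :=
  exists T : tester R n, valid_tester T /\
    forall rho sigma, density rho -> density sigma ->
      accProb T rho sigma m [::] = f rho sigma.

Lemma realizable_bounds (R : realType) (n m : nat) f rho sigma :
  @realizable R n m f -> density rho -> density sigma -> 0 <= f rho sigma <= 1.
Proof. by move=> [T [vT Tf]] dr ds; rewrite -Tf //; apply: accProb_bounds. Qed.

Lemma realizable_compl (R : realType) (n m : nat) f :
  @realizable R n m f -> realizable m (fun rho sigma => 1 - f rho sigma).
Proof.
move=> [T [vT Tf]]; exists (complT T); split; first exact: valid_complT.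
by move=> rho sigma dr ds; rewrite accProb_complT // Tf.
Qed.

Lemma realizableM (R : realType) (n m1 m2 : nat) f g :
  @realizable R n m1 f -> realizable m2 g ->
  realizable (m1 + m2) (fun rho sigma => f rho sigma * g rho sigma).
Proof.
move=> [T [vT Tf]] [U [vU Ug]]; exists (seqT m1 T U); split; first exact: valid_seqT.
by move=> rho sigma dr ds; rewrite accProb_seqT // Tf // Ug.
Qed.

Lemma realizable1 (R : realType) (n : nat) : @realizable R n 0 (fun _ _ => 1).
Proof.
exists (Tester (fun _ a => (a == (true, pauli_id n))%:R) (fun => 1)); split=> //.
split; first by move=> h a /=; rewrite ler0n.
split=> h /=; last by rewrite ler01 lexx.
by rewrite (bigD1 (true, pauli_id n)) //= eqxx big1 ?addr0 // => a /negPf ->.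
Qed.

Lemma realizable_prod (R : realType) (n : nat) (I : Type) (r : seq I) (m : I -> nat) f :
  (forall i, @realizable R n (m i) (f i)) ->
  realizable (\sum_(i <- r) m i) (fun rho sigma => \prod_(i <- r) f i rho sigma).
Proof.
move=> rf; elim: r => [|i r IH].
  have [T [vT T1]] := realizable1 R n; exists T; split=> // rho sigma dr ds.
  by rewrite !big_nil T1.
have [T [vT Tf]] := realizableM (rf i) IH; exists T; split=> // rho sigma dr ds.
by rewrite !big_cons Tf.
Qed.

Lemma realizableX (R : realType) (n m k : nat) f :
  @realizable R n m f -> realizable (k * m) (fun rho sigma => f rho sigma ^+ k).
Proof.
move=> rf; have [T [vT Tf]] := @realizable_prod _ _ _ (iota 0 k) (fun=> m) (fun=> f) (fun=> rf).
exists T; split=> // rho sigma dr ds; rewrite -[in RHS](size_iota 0 k).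
move: (Tf rho sigma dr ds).
by rewrite !big_const_seq count_predT size_iota iter_addn_0 mulnC iter_mulr_1.
Qed.

Lemma realizable_mix (R : realType) (n m : nat)
    (fs : {ffun 'I_n -> 'I_4} -> 'M[R[i]]_(2 ^ n) -> 'M[R[i]]_(2 ^ n) -> R) :
  (forall s, @realizable R n m (fs s)) ->
  realizable m.+1 (fun rho sigma => (4%:R ^+ n)^-1 * \sum_s fs s rho sigma).
Proof.
move=> rf; have [Ts vTs] := fin_all_exists rf.
exists (mixT Ts); split; first by apply: valid_mixT => s; case: (vTs s).
move=> rho sigma dr ds; rewrite accProb_mixT //; congr (_ * _).
by apply: eq_bigr => s _; case: (vTs s) => _ ->.
Qed.

(** * The second-moment test for a single Pauli string *)

Definition stat (R : realType) (n : nat) (h : history n) : R :=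
  \sum_(x <- h) sgb R x.1.1 * sgb R x.2.

Lemma stat_rcons (R : realType) (n : nat) (h : history n) x :
  stat R (rcons h x) = stat R h + sgb R x.1.1 * sgb R x.2.
Proof. by rewrite /stat -cats1 big_cat big_seq1. Qed.

(** Copies alternate, starting with [rho]; since [stat] counts outcomes on [sigma] negatively, it
    estimates the difference of the two coefficients. *)
Definition pairT (R : realType) (n : nat) (s : {ffun 'I_n -> 'I_4}) (acc : R -> R) :
    tester R n :=
  Tester (fun h a => (a == (~~ odd (size h), s))%:R) (fun h => acc (stat R h)).

Lemma valid_pairT (R : realType) (n : nat) (s : {ffun 'I_n -> 'I_4}) (acc : R -> R) :
  (forall x, 0 <= acc x <= 1) -> valid_tester (pairT s acc).
Proof.
move=> a01; split; first by move=> h a /=; rewrite ler0n.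
split=> h /=; last exact: a01.
rewrite (bigD1 (~~ odd (size h), s)) //= eqxx big1 ?addr0 //.
by move=> a /negPf ->.
Qed.

Definition pair_mean (R : realType) (n : nat) (rho sigma : 'M[R[i]]_(2 ^ n)) s (t : nat) : R :=
  \sum_(i < t) (if odd i then - expval sigma s else expval rho s).

Lemma pair_mean_double (R : realType) (n : nat) (rho sigma : 'M[R[i]]_(2 ^ n)) s k :
  pair_mean rho sigma s (2 * k) = k%:R * (expval rho s - expval sigma s).
Proof.
rewrite /pair_mean; elim: k => [|k IH]; first by rewrite muln0 big_ord0 mul0r.
rewrite mulnS !addSn add0n !big_ord_recr /= IH mul2n odd_double /= -natr1; ring.
Qed.

(** Chebyshev's inequality by induction on the remaining steps: the conditional second moment of the
    deviation grows by at most [1] per measurement, which accounts for [k%:R]. Bounding [acc] below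
    by a quadratic turns the tail bound into a moment computation. *)
Lemma pairT_chebyshev (R : realType) (n m : nat) (rho sigma : 'M[R[i]]_(2 ^ n)) s
    (acc : R -> R) (tau : R) k h :
  density rho -> density sigma -> 0 < tau ->
  (forall x, 1 - (x - pair_mean rho sigma s m) ^+ 2 / tau <= acc x) ->
  (size h + k = m)%N ->
  1 - ((stat R h - pair_mean rho sigma s (size h)) ^+ 2 + k%:R) / tau
    <= accProb (pairT s acc) rho sigma k h.
Proof.
move=> dr ds tau0 hacc; elim: k h => [|k IH] h sz /=.
  by rewrite addr0 -[size h]addn0 sz.
set a0 := (~~ odd (size h), s).
rewrite (bigD1 a0) //= eqxx mul1r [X in _ <= _ + X]big1 ?addr0; last first.
  by move=> a /negPf ->; rewrite mul0r.
set st := if ~~ _ then rho else sigma.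
have dst : density st by rewrite /st; case: ifP.
have tr1 : \tr st = 1 by case: dst.
pose u := stat R h - pair_mean rho sigma s (size h).
pose w := sgb R a0.1; pose v := expval st s.
have ww : w ^+ 2 = 1 by rewrite /w /sgb; case: ifP => _; ring.
have step b : 1 - ((u + w * (sgb R b - v)) ^+ 2 + k%:R) / tau
    <= accProb (pairT s acc) rho sigma k (rcons h (a0, b)).
  have szb : (size (rcons h (a0, b)) + k = m)%N by rewrite size_rcons -sz addnS.
  apply: le_trans (IH _ szb); rewrite stat_rcons size_rcons /pair_mean big_ord_recr /=.
  rewrite le_eqVlt; apply/orP; left; apply/eqP; congr (1 - (_ ^+ 2 + _) / _).
  rewrite /u /pair_mean /w /v /st /=; case: (odd (size h)) => /=; rewrite /sgb; ring.
have lower : \sum_b outcomeProb st s b *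
      (1 - ((u + w * (sgb R b - v)) ^+ 2 + k%:R) / tau)
    <= \sum_b outcomeProb st s b * accProb (pairT s acc) rho sigma k (rcons h (a0, b)).
  by apply: ler_sum => b _; rewrite ler_wpM2l // outcomeProb_ge0.
apply: le_trans lower; rewrite -/u big_bool !outcomeProbE // -/v /sgb /=.
(* The centred outcome has mean zero, so the cross term with [u] disappears and the variance
   [1 - v ^+ 2] remains. *)
have -> : (1 + 1 * v) / 2 * (1 - ((u + w * (1 - v)) ^+ 2 + k%:R) / tau) +
  (1 + -1 * v) / 2 * (1 - ((u + w * (-1 - v)) ^+ 2 + k%:R) / tau)
  = 1 - (u ^+ 2 + w ^+ 2 * (1 - v ^+ 2) + k%:R) / tau.
  by field; rewrite gt_eqF.
rewrite ww mul1r lerD2l lerN2 ler_pM2r ?invr_gt0 // -natr1.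
by have := sqr_ge0 v; lra.
Qed.

(** In absolute value [x] is at most half of [y], so the distance is at least half of [y]. *)
Lemma sqr_dist_ge (R : realType) (x y T : R) :
  x ^+ 2 <= T -> 4 * T <= y ^+ 2 -> T <= (x - y) ^+ 2.
Proof.
move=> hx hy; have h1 : 2 * `|x| <= `|y|.
  rewrite -[2]ger0_norm // -normrM -ler_sqr ?nnegrE // !real_normK ?num_real //.
  by rewrite exprMn; lra.
have h2 : `|y| - `|x| <= `|x - y| by rewrite distrC; apply: lerB_dist.
have y0 := normr_ge0 y; have x0 := normr_ge0 x.
have -> : (x - y) ^+ 2 = `|x - y| ^+ 2 by rewrite real_normK ?num_real.
have : y ^+ 2 = `|y| ^+ 2 by rewrite real_normK ?num_real.
by nra.
Qed.

Lemma realizable_detect (R : realType) (n k : nat) (s : {ffun 'I_n -> 'I_4}) (G : R) :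
  (0 < k)%N -> 0 < G ->
  exists q, realizable (2 * k) q /\
    forall rho sigma, density rho -> density sigma ->
    (rho = sigma -> q rho sigma <= 8 / (k%:R * G)) /\
    (G <= (expval rho s - expval sigma s) ^+ 2 -> 1 - 8 / (k%:R * G) <= q rho sigma).
Proof.
move=> k0 G0; have k0' : 0 < k%:R :> R by rewrite ltr0n.
(* The threshold on [|stat|] is half of [k * sqrt G], the least mean size when the difference is
   large. With variance at most [2 * k], either error is at most [2 * k / tau = 8 / (k * G)]. *)
pose tau : R := k%:R ^+ 2 * G / 4.
have tau0 : 0 < tau by rewrite /tau divr_gt0 // mulr_gt0 // exprn_gt0.
pose acc (x : R) : R := (tau <= x ^+ 2)%R%:R.
have acc01 x : 0 <= acc x <= 1 by rewrite /acc; case: (tau <= x ^+ 2)%R; rewrite ?lexx ?ler01.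
have vT := valid_pairT s acc01.
have E : (2 * k)%:R / tau = 8 / (k%:R * G).
  by rewrite natrM /tau; field; rewrite !gt_eqF.
exists (fun rho sigma => accProb (pairT s acc) rho sigma (2 * k) [::]).
split; first by exists (pairT s acc).
move=> rho sigma dr ds; split=> [eq_rs|far].
  (* Chebyshev bounds acceptance from below, so a false alarm is bounded through the complementary
     test. *)
  have := @pairT_chebyshev R n (2 * k) rho sigma s (fun x => 1 - acc x) tau (2 * k) [::] dr ds tau0.
  have -> : accProb (pairT s (fun x => 1 - acc x)) rho sigma (2 * k) [::]
     = 1 - accProb (pairT s acc) rho sigma (2 * k) [::].
    exact: (accProb_complT (2 * k) [::] vT dr ds).
  rewrite /stat /pair_mean big_nil big_ord0 subr0 expr0n /= add0r E => H.
  have {}H : 1 - 8 / (k%:R * G) <= 1 - accProb (pairT s acc) rho sigma (2 * k) [::].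
    apply: H => // x; rewrite -/(pair_mean _ _ _ _) pair_mean_double eq_rs subrr mulr0 subr0 /acc.
    case: (leP tau (x ^+ 2)) => [|_].
      by move=> h /=; rewrite subrr subr_le0 ler_pdivlMr // mul1r.
    by rewrite /= subr0 gerBl divr_ge0 ?sqr_ge0 // ltW.
  by lra.
have := @pairT_chebyshev R n (2 * k) rho sigma s acc tau (2 * k) [::] dr ds tau0.
rewrite /stat /pair_mean big_nil big_ord0 subr0 expr0n /= add0r E; apply => // x.
rewrite -/(pair_mean _ _ _ _) pair_mean_double /acc.
case: (leP tau (x ^+ 2)) => [_|/ltW h] /=.
  by rewrite gerBl divr_ge0 ?sqr_ge0 // ltW.
rewrite subr_le0 ler_pdivlMr // mul1r; apply: sqr_dist_ge => //.
rewrite exprMn /tau; have : 0 < k%:R ^+ 2 :> R by rewrite exprn_gt0.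
by move=> k2; rewrite mulrC divfK ?pnatr_eq0 // ler_pM2l.
Qed.

(** * Upper bound *)

Lemma expr_1B_ge (R : realType) (y F : R) M :
  0 <= F <= 1 -> 1 - y <= F -> 1 - M%:R * y <= F ^+ M.
Proof.
move=> F01 hF; elim: M => [|M IH]; first by rewrite mul0r subr0.
have : 0 <= F ^+ M <= 1 by case/andP: F01 => F0 F1; rewrite exprn_ge0 // exprn_ile1.
by rewrite exprS -natr1; nra.
Qed.

(** The union bound for independent events. *)
Lemma prod_1B_ge (R : realType) (I : Type) (r : seq I) (F y : I -> R) :
  (forall i, 0 <= F i <= 1) -> (forall i, 1 - y i <= F i) ->
  1 - \sum_(i <- r) y i <= \prod_(i <- r) F i.
Proof.
move=> F01 hF.
suff [] : 0 <= \prod_(i <- r) F i <= 1 /\ 1 - \sum_(i <- r) y i <= \prod_(i <- r) F i by [].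
elim: r => [|i r [IH1 IH2]]; first by rewrite !big_nil; split; lra.
rewrite !big_cons; move: (F01 i) (hF i) IH1 IH2 => /andP[a0 a1] h /andP[b0 b1] h'.
split; first by rewrite mulr_ge0 // mulr_ile1.
by nra.
Qed.

(** Bernoulli-type bound [(1 - x) ^+ M <= 1 / (1 + M x)], used in place of an exponential. *)
Lemma expr_1B_le (R : realType) (x : R) M :
  0 <= x <= 1 -> (1 - x) ^+ M * (1 + M%:R * x) <= 1.
Proof.
move=> x01; elim: M => [|M IH]; first by rewrite mul0r addr0 mul1r.
apply: le_trans IH; rewrite exprSr -mulrA ler_wpM2l //.
  by rewrite exprn_ge0 // subr_ge0; case/andP: x01.
have : 0 <= M%:R :> R by [].
by rewrite -natr1; nra.
Qed.

(** At the largest scale [j] whose threshold [2 ^+ j * mu / 2] is reached, [v] lies below the next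
    threshold, which is [2 ^+ j * mu]. *)
Lemma le_dyadic_sum (R : realType) (v mu : R) J : 0 <= mu -> v < 2 ^+ J * mu / 2 ->
  v <= mu / 2 + \sum_(j < J) 2 ^+ j * mu * (2 ^+ j * mu / 2 <= v)%R%:R.
Proof.
move=> mu0; elim: J => [|J IH]; first by rewrite big_ord0 expr0; lra.
rewrite exprS big_ord_recr /= => hv.
have s0 : 0 <= \sum_(j < J) 2 ^+ j * mu * (2 ^+ j * mu / 2 <= v)%R%:R.
  by apply: sumr_ge0 => j _; rewrite !mulr_ge0 // exprn_ge0.
have p0 : 0 <= 2 ^+ J * mu by rewrite mulr_ge0 // exprn_ge0.
case: (leP (2 ^+ J * mu / 2) v) => [_|/IH h] /=; last by lra.
by rewrite mulr1; lra.
Qed.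

(* Either some scale is populated, or no entry exceeds the top scale and the
   [2 n] lower ones contribute too little to the average. *)
Lemma exists_dyadic_scale (R : realType) (n : nat) (I : finType) (v : I -> R) (mu : R) :
  (0 < n)%N -> #|I| = (4 ^ n)%N -> 0 < mu -> 4 ^+ n * mu < \sum_i v i ->
  exists j : 'I_(2 * n).+1,
    4 ^+ n <= 2 ^+ j * (6 * n)%:R * \sum_i (2 ^+ j * mu / 2 <= v i)%R%:R :> R.
Proof.
move=> n0 cI mu0 hv; apply/existsP; apply: contraLR hv => /existsPn H.
pose c (j : nat) : R := \sum_i (2 ^+ j * mu / 2 <= v i)%R%:R.
have {}H (j : nat) : (j < (2 * n).+1)%N -> 2 ^+ j * (6 * n)%:R * c j < 4 ^+ n.
  by move=> hj; have := H (Ordinal hj); rewrite -ltNge.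
have n0' : 1 <= n%:R :> R by rewrite ler1n.
have p4 : 0 < 4 ^+ n :> R by rewrite exprn_gt0.
have e4 : 2 ^+ (2 * n) = 4 ^+ n :> R by rewrite exprM; congr (_ ^+ _); ring.
(* As [2 ^+ (2 * n) = 4 ^+ n], one entry at the top scale would already populate it. *)
have top i : v i < 2 ^+ (2 * n) * mu / 2.
  rewrite ltNge; apply/negP => hi.
  have c1 : 1 <= c (2 * n)%N.
    by rewrite /c (bigD1 i) //= hi lerDl; apply: sumr_ge0.
  have := H (2 * n)%N (ltnSn _); rewrite e4 natrM.
  apply/negP; rewrite -leNgt -mulrA ler_peMr ?(ltW p4) //; nra.
rewrite -leNgt.
have -> : 4 ^+ n * mu = \sum_(i : I) mu.
  by rewrite sumr_const cI -[RHS]mulr_natl natrX.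
apply: le_trans (ler_sum _ (fun i _ => le_dyadic_sum (ltW mu0) (top i))) _.
rewrite big_split /= exchange_big /= !sumr_const cI.
rewrite -[mu / 2 *+ _]mulr_natl -[mu *+ _]mulr_natl natrX.
(* The factor [6 * n] makes the [2 * n] lower scales contribute at most a third of [4 ^+ n * mu];
   the entries below all scales add a half. *)
have hj (j : 'I_(2 * n)) : \sum_(i : I) 2 ^+ j * mu * (2 ^+ j * mu / 2 <= v i)%R%:R
    <= 4 ^+ n * mu / (6 * n%:R).
  rewrite -mulr_sumr -/(c j) ler_pdivlMr ?mulr_gt0 ?ltr0n //.
  have := H j (ltnW (ltn_ord j)); rewrite natrM.
  have -> : 2 ^+ j * mu * c j * (6 * n%:R) = mu * (2 ^+ j * (6 * n%:R) * c j) by ring.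
  by move=> h; rewrite [leRHS]mulrC ler_pM2l // ltW.
have : \sum_(j < 2 * n) \sum_(i : I) 2 ^+ j * mu * (2 ^+ j * mu / 2 <= v i)%R%:R
    <= \sum_(j < 2 * n) 4 ^+ n * mu / (6 * n%:R) by apply: ler_sum.
rewrite sumr_const card_ord -[_ *+ (2 * n)]mulr_natl natrM.
have -> : 2 * n%:R * (4 ^+ n * mu / (6 * n%:R)) = 4 ^+ n * mu / 3 :> R.
  by field; rewrite pnatr_eq0 -lt0n.
by have : 0 < 4 ^+ n * mu by [rewrite mulr_gt0]; lra.
Qed.

(** For a random string, reject only if all [L] detections fire. For equal states this has
    probability at most the [L]-th power of the single error; for a string with a large difference
    the union bound leaves at least [1 / 2], whence the factor [2] in the denominator. *)
Lemma realizable_block (R : realType) (n k L : nat) (G : R) :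
  (0 < k)%N -> 0 < G -> L%:R * (8 / (k%:R * G)) <= 1 / 2 -> 8 / (k%:R * G) <= 1 ->
  exists f, realizable (L * (2 * k)).+1 f /\
    forall rho sigma : 'M[R[i]]_(2 ^ n), density rho -> density sigma ->
    (rho = sigma -> 1 - (8 / (k%:R * G)) ^+ L <= f rho sigma) /\
    f rho sigma <= 1 - (\sum_s (G <= (expval rho s - expval sigma s) ^+ 2)%R%:R)
                        / (2 * 4 ^+ n).
Proof.
move=> k0 G0 hL b1; set be := 8 / _ in hL b1 *.
have be0 : 0 <= be by rewrite divr_ge0 // mulr_ge0 // ltW.
have [q hq] := fin_all_exists (fun s => @realizable_detect R n k s G k0 G0).
have p4 : 4 ^+ n != 0 :> R by rewrite expf_neq0 // pnatr_eq0.
have avg (c : R) : c = (4 ^+ n)^-1 * \sum_(s : {ffun 'I_n -> 'I_4}) c.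
  by rewrite sumr_const card_pauli -[_ *+ (4 ^ n)]mulr_natl natrX mulKf.
have p4' : 0 <= (4 ^+ n)^-1 :> R by rewrite invr_ge0 exprn_ge0.
exists (fun rho sigma => (4%:R ^+ n)^-1 * \sum_s (1 - q s rho sigma ^+ L)); split.
  apply: (realizable_mix (fs := fun s rho sigma => 1 - q s rho sigma ^+ L)) => s.
  by apply: realizable_compl; apply: realizableX; case: (hq s).
move=> rho sigma dr ds.
have q01 s : 0 <= q s rho sigma <= 1.
  by case: (hq s) => rq _; apply: realizable_bounds rq dr ds.
split=> [eq_rs|].
  rewrite [leLHS]avg ler_wpM2l //; apply: ler_sum => s _; rewrite lerD2l lerN2.
  case: (hq s) => _ /(_ rho sigma dr ds) [/(_ eq_rs) le_be _].
  by case/andP: (q01 s) => s0 s1; apply: lerXn2r; rewrite ?nnegrE.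
rewrite [leRHS](_ : _ = (4 ^+ n)^-1 * \sum_s
    (1 - (G <= (expval rho s - expval sigma s) ^+ 2)%R%:R / 2)); last first.
  by rewrite sumrB mulrBr -avg -mulr_suml; congr (_ - _); field.
rewrite ler_wpM2l //; apply: ler_sum => s _; rewrite lerD2l lerN2.
case: (leP G ((expval rho s - expval sigma s) ^+ 2)) => [far|_] /=; last first.
  by rewrite mul0r exprn_ge0 //; case/andP: (q01 s).
case: (hq s) => _ /(_ rho sigma dr ds) [_ /(_ far) ge_be].
by have := expr_1B_ge L (q01 s) ge_be; rewrite -/be; lra.
Qed.

Lemma sum_pow2 (R : realType) J : \sum_(j < J) 2 ^+ j = 2 ^+ J - 1 :> R.
Proof.
elim: J => [|J IH]; first by rewrite big_ord0 subrr.
by rewrite big_ord_recr /= IH exprS; ring.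
Qed.

Lemma upper_bound (R : realType) (n : nat) (eps : R) :
  (1 <= n)%N -> 0 < eps <= 1 ->
  exists (m : nat) (T : tester R n), valid_tester T /\ solves eps m T /\
        m%:R <= (3 * (432 * 128)) * (n%:R ^+ 4 * 4%:R ^+ n) / eps ^+ 2.
Proof.
move=> n1 /andP[eps0 eps1].
have n1' : 1 <= n%:R :> R by rewrite ler1n.
have n0' : 0 < n%:R :> R by rewrite ltr0n.
have p4 : 0 < 4 ^+ n :> R by rewrite exprn_gt0.
have e20 : 0 < eps ^+ 2 by rewrite exprn_gt0.
have e21 : eps ^+ 2 <= 1 by rewrite expr_le1 // ltW.
pose mu := eps ^+ 2 / 4 ^+ n.
have mu0 : 0 < mu by rewrite divr_gt0.
have p2 (j : nat) : 0 < 2 ^+ j :> R by rewrite exprn_gt0.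
pose G (j : nat) := 2 ^+ j * mu / 2.
have G0 j : 0 < G j by rewrite divr_gt0 // mulr_gt0.
(* Taking [k j] above [x j] brings the single error [be j] below [1 / (8 n)], so that [4 * n]
   unanimous detections still fire with probability at least [1 / 2]. *)
pose x (j : nat) := 64 * n%:R / G j.
have x0 j : 0 < x j by rewrite divr_gt0 // mulr_gt0.
pose k (j : nat) := (Num.truncn (x j)).+1.
have k_gt j : x j < (k j)%:R.
  by have /andP[] := truncn_itv (ltW (x0 j)).
have e4 : 2 ^+ (2 * n) = 4 ^+ n :> R by rewrite exprM; congr (_ ^+ _); ring.
(* This makes rounding [x j] up to an integer cost at most a factor [2]. *)
have x1 (j : 'I_(2 * n).+1) : 1 <= x j.
  rewrite /x ler_pdivlMr // mul1r /G /mu.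
  have hj : 2 ^+ j <= 4 ^+ n :> R.
    by rewrite -e4 ler_weXn2l ?ler1n // -ltnS.
  have : 2 ^+ j * (eps ^+ 2 / 4 ^+ n) <= 1.
    rewrite mulrA ler_pdivrMr // mul1r; apply: le_trans hj.
    by rewrite ler_piMr // ltW.
  by lra.
have k_le (j : 'I_(2 * n).+1) : (k j)%:R <= 2 * x j.
  have /andP[h _] := truncn_itv (ltW (x0 j)).
  by have := x1 j; rewrite /k -natr1; lra.
pose be (j : nat) := 8 / ((k j)%:R * G j).
have be_le j : be j <= (8 * n%:R)^-1.
  have kG : 0 < (k j)%:R * G j by rewrite mulr_gt0 ?ltr0n.
  have n8 : 0 < 8 * n%:R :> R by rewrite mulr_gt0.
  rewrite /be ler_pdivrMr // mulrC ler_pdivlMr //.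
  by have := k_gt j; rewrite /x ltr_pdivrMr // => /ltW; lra.
have be0 j : 0 <= be j by rewrite divr_ge0 // mulr_ge0 // ltW.
have hL j : (4 * n)%:R * be j <= 1 / 2.
  apply: le_trans (_ : (4 * n)%:R * (8 * n%:R)^-1 <= _).
    by rewrite ler_wpM2l.
  by rewrite natrM le_eqVlt; apply/orP; left; apply/eqP; field; rewrite gt_eqF.
have be8 j : be j <= 8^-1.
  apply: le_trans (be_le j) _; rewrite lef_pV2 ?posrE ?mulr_gt0 //; lra.
have be1 j : be j <= 1 by apply: le_trans (be8 j) _; lra.
have [f hf] := fin_all_exists (fun j : 'I_(2 * n).+1 =>
  @realizable_block R n (k j) (4 * n) (G j) isT (G0 j) (hL j) (be1 j)).
(* At a populated scale one block rejects with probability at least [1 / (12 n 2 ^ j)]; [M j] blocks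
   give an expected number of rejections of at least [2]. *)
pose M (j : nat) := (2 ^ j * (24 * n))%N.
have [T [vT Tf]] := @realizable_prod R n _ (index_enum 'I_(2 * n).+1)
  (fun j => M j * (4 * n * (2 * k j)).+1)%N (fun j rho sigma => f j rho sigma ^+ M j)
  (fun j => realizableX (M j) (hf j).1).
exists (\sum_(j < (2 * n).+1) M j * (4 * n * (2 * k j)).+1)%N, T.
split=> //; split.
  move=> rho sigma dr ds; rewrite Tf //.
  have f01 j : 0 <= f j rho sigma <= 1.
    by case: (hf j) => rf _; apply: realizable_bounds rf dr ds.
  have F01 j : 0 <= f j rho sigma ^+ M j <= 1.
    by case/andP: (f01 j) => h0 h1; rewrite exprn_ge0 // exprn_ile1.
  split=> [eq_rs|far].
    have hF (j : 'I_(2 * n).+1) : 1 - (M j)%:R * (8^-1) ^+ (4 * n) <= f j rho sigma ^+ M j.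
      apply: expr_1B_ge => //; case: (hf j) => _ /(_ rho sigma dr ds) [/(_ eq_rs) h _].
      apply: le_trans h; rewrite lerD2l lerN2; apply: lerXn2r; rewrite ?nnegrE //.
      - exact: be0.
      - by rewrite invr_ge0.
      - exact: be8.
    apply: le_trans (prod_1B_ge _ F01 hF).
    rewrite -mulr_suml.
    have -> : \sum_(j < (2 * n).+1) (M j)%:R = (2 * 4 ^+ n - 1) * (24 * n%:R) :> R.
      by rewrite -e4 -exprS -sum_pow2 mulr_suml; apply: eq_bigr => j _; rewrite /M !natrM natrX.
    (* There are fewer than [48 n 4 ^ n] blocks in total, and [144 = 3 * 48] brings the union bound
       over false alarms down to [1 / 3]. The estimate follows from [n <= 2 ^ n] and
       [144 * 2 * 4 <= 8 ^ 4]. *)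
    have h8 : 144 * (n%:R * 4 ^+ n) <= 8 ^+ (4 * n) :> R.
      rewrite -!natrX -!natrM ler_nat expnM.
      apply: (@leq_trans (144 ^ n * (2 ^ n * 4 ^ n)))%N; last first.
        by rewrite -!expnMn leq_exp2r.
      apply: leq_mul; first by rewrite -[X in (X <= _)%N]expn1 leq_exp2l.
      by rewrite leq_mul2r ltnW ?orbT // ltn_expl.
    have p8 : 0 < 8 ^+ (4 * n) :> R by rewrite exprn_gt0.
    have -> : (8^-1) ^+ (4 * n) = (8 ^+ (4 * n))^-1 :> R by rewrite exprVn.
    have : (2 * 4 ^+ n - 1) * (24 * n%:R) / 8 ^+ (4 * n) <= 1 / 3 :> R.
      by rewrite ler_pdivrMr //; nra.
    by lra.
  have : 4 ^+ n * mu < \sum_s (expval rho s - expval sigma s) ^+ 2.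
    rewrite /mu mulrC divfK ?gt_eqF //; exact: trnorm_gt_sum_expval.
  case/(exists_dyadic_scale n1 (card_pauli n) mu0) => j hj.
  (* The populated scale alone forces rejection; the other factors are at most [1]. *)
  rewrite (bigD1 j) //=.
  apply: (@le_trans _ _ (f j rho sigma ^+ M j)).
    rewrite ler_piMr //; first by case/andP: (F01 j).
    by apply: prodr_ile1 => i.
  case: (hf j) => _ /(_ rho sigma dr ds) [_]; rewrite -/(G j) in hj *.
  set c := \sum_s _ in hj *; set y := c / _ => fle.
  have c0 : 0 <= c by apply: sumr_ge0.
  have y0 : 0 <= y by rewrite divr_ge0 // mulr_ge0 // ltW.
  have y1 : y <= 1 by case/andP: (f01 j) => h0 _; lra.
  have y01 : 0 <= y <= 1 by rewrite y0.
  apply: (@le_trans _ _ ((1 - y) ^+ M j)).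
    by apply: lerXn2r => //; rewrite nnegrE; [case/andP: (f01 j) | lra].
  (* Then [expr_1B_le] bounds acceptance by [1 / (1 + 2)]. *)
  have My : 2 <= (M j)%:R * y.
    rewrite /y mulrA ler_pdivlMr ?mulr_gt0 //; move: hj; rewrite /M !natrM natrX; lra.
  have := expr_1B_le (M j) y01.
  have : 0 <= (1 - y) ^+ M j by rewrite exprn_ge0 // subr_ge0.
  by nra.
rewrite natr_sum.
(* All scales receive the same bound, since the [2 ^+ j] in [M j] cancels the one in [G j]. Here
   [432 = 24 * 18] and [128 = 64 * 2]; the [2 * n + 1 <= 3 * n] scales give the fourth power of
   [n]. *)
apply: (@le_trans _ _ (\sum_(j < (2 * n).+1) 432 * 128 * (n%:R ^+ 3 * 4 ^+ n) / eps ^+ 2)).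
  apply: ler_sum => j _; rewrite /M natrM -[(4 * n * _).+1%:R]natr1 !natrM natrX.
  have k1 : 1 <= (k j)%:R :> R by rewrite ler1n.
  have h1 : 4 * n%:R * (2 * (k j)%:R) + 1 <= 18 * n%:R * x j :> R.
    by have := k_le j; nra.
  apply: (@le_trans _ _ (2 ^+ j * (24 * n%:R) * (18 * n%:R * x j))).
    by rewrite ler_wpM2l // !mulr_ge0 // ltW.
  rewrite le_eqVlt; apply/orP; left; apply/eqP; rewrite /x /G /mu.
  by field; rewrite !gt_eqF.
rewrite sumr_const card_ord -[_ *+ (2 * n).+1]mulr_natl -natr1 natrM.
have -> : 3 * (432 * 128) * (n%:R ^+ 4 * 4 ^+ n) / eps ^+ 2
   = (3 * n%:R) * (432 * 128 * (n%:R ^+ 3 * 4 ^+ n) / eps ^+ 2) :> R.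
  by field; rewrite gt_eqF.
rewrite ler_wpM2r //; last lra.
by rewrite divr_ge0 ?(ltW e20) // !mulr_ge0 ?exprn_ge0 // ltW.
Qed.

(** * Lower bound *)

(** At [e = 0] this is the maximally mixed state, whatever [s] is. *)
Definition pstate (R : realType) (n : nat) (e : R) (s : {ffun 'I_n -> 'I_4}) :
    'M[R[i]]_(2 ^ n) :=
  ((2 ^ n)%:R^-1 : R[i]) *: (1%:M + (e%:C)%C *: pauli R[i] s).

Lemma natr_2X_neq0 (C : numFieldType) (n : nat) : (2 ^ n)%:R != 0 :> C.
Proof. by rewrite pnatr_eq0 expn_eq0. Qed.

Lemma conj_realC (R : realType) (x : R) : ((x%:C)%C : R[i])^* = (x%:C)%C.
Proof. by apply/CrealP; apply/complex_realP; exists x. Qed.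

Lemma psd_mulmx_adj (C : numClosedFieldType) (N : nat) (X : 'M[C]_N) (v : 'rV[C]_N) :
  0 <= (v *m (X *m adjmx X) *m map_mx Num.conj (v^T)) 0 0.
Proof.
have -> : v *m (X *m adjmx X) *m map_mx Num.conj (v^T)
    = (v *m X) *m map_mx Num.conj ((v *m X)^T).
  by rewrite trmx_mul map_mxM !mulmxA.
by rewrite mxE sumr_ge0 // => k _; rewrite !mxE mul_conjC_ge0.
Qed.

(** [1 + e P] is a combination of [1 + P] and [1 - P] with nonnegative weights [(1 + e) / 2] and
    [(1 - e) / 2], and each of these is half of its own square. *)
Lemma psd_1D_pauli (C : numClosedFieldType) (n : nat) (e : C) s (v : 'rV[C]_(2 ^ n)) :
  -1 <= e -> e <= 1 ->
  0 <= (v *m (1%:M + e *: pauli C s) *m map_mx Num.conj (v^T)) 0 0.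
Proof.
move=> em eM; set P := pauli C s.
have sq (f : C) : f * f = 1 -> f^* = f ->
    (1%:M + f *: P) *m adjmx (1%:M + f *: P) = 2%:R *: (1%:M + f *: P).
  move=> ff cf; rewrite adjmxD adjmxZ adjmx1 adjmx_pauli cf mulmxDl !mulmxDr.
  rewrite mul1mx mulmx1 mul1mx -scalemxAl -scalemxAr pauli_sqr scalerA ff scale1r.
  by rewrite scaler_nat mulr2n [f *: P + 1%:M]addrC.
have sq1 := sq 1 (mulr1 1) (conjC1 _).
have cN1 : (-1 : C)^* = -1 by rewrite rmorphN /= conjC1.
have N11 : -1 * -1 = 1 :> C by rewrite mulrNN mulr1.
have sqN1 := sq (-1) N11 cN1.
have -> : 1%:M + e *: P = ((1 + e) / 4) *: ((1%:M + 1 *: P) *m adjmx (1%:M + 1 *: P))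
    + ((1 - e) / 4) *: ((1%:M + (-1) *: P) *m adjmx (1%:M + (-1) *: P)).
  rewrite sq1 sqN1 !scalerA !scalerDr !scalerA mulr1 mulrN1 addrACA -!scalerDl.
  have -> : (1 + e) / 4 * 2 + (1 - e) / 4 * 2 = 1 by field.
  have -> : (1 + e) / 4 * 2 - (1 - e) / 4 * 2 = e by field.
  by rewrite scale1r.
have quad (a : C) X : 0 <= a ->
    0 <= (v *m (a *: (X *m adjmx X)) *m map_mx Num.conj (v^T)) 0 0.
  by move=> a0; rewrite -scalemxAr -scalemxAl mxE mulr_ge0 ?psd_mulmx_adj.
rewrite mulmxDr mulmxDl mxE addr_ge0 // quad // divr_ge0 // ?subr_ge0 //.
by rewrite addrC -[1]opprK subr_ge0.
Qed.

Lemma density_pstate (R : realType) (n : nat) (e : R) (s : {ffun 'I_n -> 'I_4}) :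
  s != pauli_id n -> -1 <= e <= 1 -> density (pstate e s).
Proof.
move=> sid /andP[em eM]; split.
- by rewrite adjmxZ adjmxD adjmxZ adjmx1 adjmx_pauli conj_realC fmorphV /= conjC_nat.
- move=> v; rewrite -scalemxAr -scalemxAl mxE mulr_ge0 ?invr_ge0 //.
  apply: psd_1D_pauli.
    by rewrite -(rmorph1 (real_complex R)) -rmorphN lecR.
  by rewrite -(rmorph1 (real_complex R)) lecR.
- rewrite mxtraceZ mxtraceD mxtraceZ mxtrace1 mxtrace_pauli (negPf sid) muln0 mulr0 addr0.
  by rewrite mulVf // natr_2X_neq0.
Qed.

Lemma expval_pstate (R : realType) (n : nat) (e : R) (s t : {ffun 'I_n -> 'I_4}) :
  expval (pstate e s) t = (t == pauli_id n)%:R + e * (t == s)%:R.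
Proof.
rewrite /expval -scalemxAr mulmxDr mulmx1 -scalemxAr mxtraceZ mxtraceD mxtraceZ.
rewrite mxtrace_pauli mxtrace_pauliM !natrM.
set d : R[i] := (2 ^ n)%:R.
have d0 : d != 0 by exact: natr_2X_neq0.
have -> : d^-1 * (d * (t == pauli_id n)%:R + (e%:C)%C * (d * (t == s)%:R))
   = (((t == pauli_id n)%:R + e * (t == s)%:R)%:C)%C.
  by rewrite rmorphD rmorphM !rmorph_nat; field.
by [].
Qed.

Lemma trnorm_pstateB (R : realType) (n : nat) (e : R) (s : {ffun 'I_n -> 'I_4}) :
  0 <= e -> trnorm (pstate e s - pstate (- e) s) = ((2 * e)%:C)%C.
Proof.
move=> e0; pose c : R[i] := (2 ^ n)%:R^-1 * ((2 * e)%:C)%C.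
have EA : pstate e s - pstate (- e) s = c *: pauli R[i] s.
  rewrite /pstate -scalerBr; apply/matrixP => i j; rewrite !mxE.
  by rewrite /c rmorphN rmorphM rmorph_nat /=; ring.
have cc : c^* = c by rewrite /c rmorphM fmorphV /= conj_realC conjC_nat.
rewrite (@trnorm_scalar_gram _ _ _ c).
- by rewrite /c mulVKf // natr_2X_neq0.
- by rewrite mulr_ge0 ?invr_ge0 // ler0c mulr_ge0.
- by rewrite EA adjmxZ adjmx_pauli -scalemxAl -scalemxAr pauli_sqr scalerA cc scalemx1 expr2.
Qed.

(** Goes through [z / (1 + z) <= ln (1 + z)]. The comparison of [z - 3 z ^ 2] with [z / (1 + z)]
    amounts to [0 <= z ^ 2 (2 + 3 z)], which explains the range of [z]. *)
Lemma expR_le_1D (R : realType) (z : R) :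
  -(2 / 3) <= z -> expR (z - 3 * z ^+ 2) <= 1 + z.
Proof.
move=> hz; have z1 : 0 < 1 + z by lra.
apply: (@le_trans _ _ (expR (z / (1 + z)))).
  by rewrite ler_expR ler_pdivlMr //; have := sqr_ge0 z; nra.
rewrite -[z / _]opprK expRN -[leRHS]invrK lef_pV2 ?posrE ?expR_gt0 ?invr_gt0 //.
apply: le_trans (expR_ge1Dx _).
by rewrite le_eqVlt; apply/orP; left; apply/eqP; field; rewrite gt_eqF.
Qed.

(** The expected number of measurements of [s], on copies of either kind, when both unknown states
    are [rho]. *)
Fixpoint expCount (R : realType) (n : nat) (T : tester R n) (rho : 'M[R[i]]_(2 ^ n))
    (s : {ffun 'I_n -> 'I_4}) (k : nat) (h : history n) : R :=
  match k with
  | 0 => 0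
  | k'.+1 => \sum_(a : action n) t_choose T h a *
       ((a.2 == s)%:R + \sum_(b : bool) outcomeProb rho a.2 b *
                                          expCount T rho s k' (rcons h (a, b)))
  end.

Lemma expCount_ge0 (R : realType) (n : nat) (T : tester R n) rho s k h :
  valid_tester T -> density rho -> 0 <= expCount T rho s k h.
Proof.
move=> [T0 _] dr; elim: k h => [//|k IH] h /=.
apply: sumr_ge0 => a _; rewrite mulr_ge0 // addr_ge0 //.
by apply: sumr_ge0 => b _; rewrite mulr_ge0 // outcomeProb_ge0.
Qed.

(** Each step measures exactly one string, so the counts over all strings add up to the number of
    steps. *)
Lemma sum_expCount (R : realType) (n : nat) (T : tester R n) rho k h :
  valid_tester T -> density rho -> \sum_s expCount T rho s k h = k%:R.
Proof.
move=> [_ [T1 _]] [_ _ tr1]; elim: k h => [|k IH] h /=; first by rewrite big1.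
rewrite exchange_big /= -[RHS]mulr1 -[X in _ = _ * X](T1 h) mulr_sumr; apply: eq_bigr => a _.
rewrite -mulr_sumr mulrC; congr (_ * _); rewrite big_split /= exchange_big /=.
have -> : \sum_s (a.2 == s)%:R = 1 :> R.
  by rewrite (bigD1 a.2) //= eqxx big1 ?addr0 // => s /negPf; rewrite eq_sym => ->.
under eq_bigr => b _ do rewrite -mulr_sumr IH.
by rewrite -mulr_suml sum_outcomeProb // mul1r -natr1 addrC.
Qed.

(* [y - q] is a lower bound for the log-likelihood ratio accumulated so far: a
   measurement of [s] adds a centred increment [+-e] to [y] and [3 e^2] to [q].
   [al] is the AM-GM parameter of [|y| <= al / 2 + y^2 / (2 al)]. *)
Lemma accProb_likelihood_bound (R : realType) (n : nat) (T : tester R n)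
    (rho0 rho sigma : 'M[R[i]]_(2 ^ n)) (s : {ffun 'I_n -> 'I_4}) (e al y q : R) k h :
  valid_tester T -> density rho0 -> density rho -> density sigma ->
  expval rho0 s = 0 -> expval rho s = e -> expval sigma s = - e ->
  (forall t, t != s -> expval rho t = expval rho0 t /\ expval sigma t = expval rho0 t) ->
  0 <= e <= 2 / 3 -> 0 < al -> 0 <= q ->
  accProb T rho0 rho0 k h
    - (al / 2 + y ^+ 2 / (2 * al) + q)
    - (e ^+ 2 / (2 * al) + 3 * e ^+ 2) * expCount T rho0 s k h
  <= expR (y - q) * accProb T rho sigma k h.
Proof.
move=> vT d0 drp drm v0 vp vm vt /andP[e0 e1] al0; have [T0 [T1 TA]] := vT.
have tr0 : \tr rho0 = 1 by case: d0.
set D := e ^+ 2 / (2 * al) + 3 * e ^+ 2.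
elim: k h y q => [|k IH] h y q q0 /=.
  set A := t_accept T h; have /andP[A0 A1] : 0 <= A <= 1 by exact: TA.
  rewrite mulr0 subr0; apply: (@le_trans _ _ ((1 + (y - q)) * A)); last first.
    by rewrite ler_wpM2r // expR_ge1Dx.
  (* AM-GM for [- y * A], obtained by completing the square and using [A <= 1]. *)
  have h1 : 0 <= (al ^+ 2 + y ^+ 2 + 2 * al * y * A) / (2 * al).
    rewrite divr_ge0 // ?mulr_ge0 // ?(ltW al0) //.
    have -> : al ^+ 2 + y ^+ 2 + 2 * al * y * A
      = (al * A + y) ^+ 2 + al ^+ 2 * (1 - A) * (1 + A) by ring.
    have A2 : 0 <= (1 - A) * (1 + A) by apply: mulr_ge0; lra.
    by rewrite -mulrA addr_ge0 ?sqr_ge0 // mulr_ge0 // sqr_ge0.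
  have h2 : (al ^+ 2 + y ^+ 2 + 2 * al * y * A) / (2 * al)
      = al / 2 + y ^+ 2 / (2 * al) + y * A by field; rewrite gt_eqF.
  by rewrite h2 in h1; nra.
pose K (y q : R) := al / 2 + y ^+ 2 / (2 * al) + q.
rewrite -/(K y q).
have -> : forall X V, X - K y q - D * V
    = X - K y q * (\sum_a t_choose T h a) - D * V :> R.
  by move=> X V; rewrite T1 mulr1.
rewrite !mulr_sumr -!sumrB; apply: ler_sum => a _.
rewrite ![_ * (t_choose T h a * _)]mulrCA ![_ * t_choose T h a]mulrC -!mulrBr.
apply: ler_wpM2l => //.
case: a => w t; rewrite /= !if_same.
set st := if w then _ else _.
have dst : density st by rewrite /st; case: (w).
have trst : \tr st = 1 by case: dst.
(* Strings other than [s] have the same outcome law in both scenarios, so [y] and [q] stay as they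
   are. *)
have [->|neq] := eqVneq t s; last first.
  have Ep b : outcomeProb st t b = outcomeProb rho0 t b.
    rewrite !outcomeProbE // /st; congr ((1 + _ * _) / 2).
    by have [] := vt t neq; case: (w).
  under [in leRHS]eq_bigr => b _ do rewrite Ep.
  have -> : forall X V, X - K y q - D * (0 + V) = X - 1 * K y q - D * V :> R.
    by move=> X V; rewrite mul1r add0r.
  rewrite -(sum_outcomeProb t tr0) mulr_suml !mulr_sumr -!sumrB.
  apply: ler_sum => b _.
  rewrite ![_ * (outcomeProb _ _ _ * _)]mulrCA -!mulrBr.
  apply: ler_wpM2l (IH _ y q q0).
  by rewrite -Ep outcomeProb_ge0.
pose f : R := if w then e else - e.
have ff : f ^+ 2 = e ^+ 2 by rewrite /f; case: (w); ring.
have vst : expval st s = f.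
  by rewrite /st /f; case: (w).
(* The outcome probability of [s] changes from [1 / 2] to [(1 + sgb R b * f) / 2], so the likelihood
   ratio gains the factor [1 + sgb R b * f], estimated by [expR_le_1D]. *)
have step b : accProb T rho0 rho0 k (rcons h (w, s, b))
    - K (y + sgb R b * f) (q + 3 * e ^+ 2)
    - D * expCount T rho0 s k (rcons h (w, s, b))
    <= expR (y - q) * (1 + sgb R b * f)
       * accProb T rho sigma k (rcons h (w, s, b)).
  have q0' : 0 <= q + 3 * e ^+ 2 by rewrite addr_ge0 // mulr_ge0 // sqr_ge0.
  apply: le_trans (IH _ (y + sgb R b * f) _ q0') _.
  have /andP[acc0 _] := accProb_bounds k (rcons h (w, s, b)) vT drp drm.
  apply: ler_wpM2r => //.
  have -> : y + sgb R b * f - (q + 3 * e ^+ 2)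
     = (y - q) + (sgb R b * f - 3 * (sgb R b * f) ^+ 2).
    have -> : (sgb R b * f) ^+ 2 = e ^+ 2.
      by rewrite exprMn ff /sgb; case: (b); ring.
    by ring.
  rewrite expRD ler_wpM2l ?expR_ge0 // expR_le_1D //.
  by rewrite /sgb /f; case: (b); case: (w); lra.
have Est b : outcomeProb st s b = (1 + sgb R b * f) / 2 by rewrite outcomeProbE // vst.
have E0 b : outcomeProb rho0 s b = 1 / 2 by rewrite outcomeProbE // v0 mulr0 addr0.
rewrite !big_bool /= !Est !E0; move: (step true) (step false); rewrite /K /sgb.
set X1 := accProb _ _ _ _ _; set X2 := accProb _ _ _ _ _.
set Y1 := accProb _ _ _ _ _; set Y2 := accProb _ _ _ _ _.
set V1 := expCount _ _ _ _ _; set V2 := expCount _ _ _ _ _.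
set x := expR _.
(* Averaged over the two equally likely outcomes, the cross terms [2 * y * f] cancel; the rest of
   the increase of [K] is [D], charged to this measurement of [s]. *)
have -> : (y + 1 * f) ^+ 2 / (2 * al) = (y ^+ 2 + e ^+ 2 + 2 * y * f) / (2 * al).
  by rewrite -ff; congr (_ / _); ring.
have -> : (y + -1 * f) ^+ 2 / (2 * al) = (y ^+ 2 + e ^+ 2 - 2 * y * f) / (2 * al).
  by rewrite -ff; congr (_ / _); ring.
by rewrite /D !mulrDl mulNr; lra.
Qed.

Lemma lower_bound (R : realType) (n m : nat) (eps : R) (T : tester R n) :
  (1 <= n)%N -> 0 < eps <= 1 -> valid_tester T -> solves eps m T ->
  16^-1 * 4%:R ^+ n / eps ^+ 2 <= m%:R.
Proof.
move=> n1 /andP[eps0 eps1] vT sol.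
have e20 : 0 < eps ^+ 2 by rewrite exprn_gt0.
(* The largest multiple of [eps] within the range of [expR_le_1D] for every [eps <= 1]; the trace
   distance [2 * e = 4 / 3 * eps] still exceeds [eps]. *)
pose e := 2 / 3 * eps.
have e01 : 0 <= e <= 2 / 3 by rewrite /e; lra.
have eN1 : -1 <= - e <= 1 by lra.
have e1 : -1 <= e <= 1 by lra.
have z1 : -1 <= (0 : R) <= 1 by lra.
have far_e : eps < 2 * e by rewrite /e; lra.
(* With [al = 1 / 3] the acceptance gap leaves [2 / 3 - 1 / 6 - 1 / 3 = 1 / 6], to be covered by
   [2 * eps ^+ 2 * W]. *)
have count_ge (X Y W : R) : 2 / 3 <= X -> Y <= 1 / 3 ->
    X - (3^-1 / 2 + 0 ^+ 2 / (2 * 3^-1) + 0) - (e ^+ 2 / (2 * 3^-1) + 3 * e ^+ 2) * W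
      <= expR (0 - 0) * Y ->
    (12 * eps ^+ 2)^-1 <= W.
  have -> : e ^+ 2 / (2 * 3^-1) + 3 * e ^+ 2 = 2 * eps ^+ 2 by rewrite /e; field.
  rewrite subrr expR0 mul1r expr0n /= => hX hY H.
  by rewrite -[leLHS]mul1r ler_pdivrMr ?mulr_gt0 //; lra.
pose V s := expCount T (pstate 0 s) s m [::].
have V_ge s : s != pauli_id n -> (12 * eps ^+ 2)^-1 <= V s.
  move=> sid; have d0 := density_pstate sid z1.
  have dp := density_pstate sid e1; have dm := density_pstate sid eN1.
  have [/(_ erefl) acc0 _] := sol _ _ d0 d0.
  have [_ acc1] := sol _ _ dp dm.
  have vs (c : R) : expval (pstate c s) s = c.
    by rewrite expval_pstate (negPf sid) eqxx add0r mulr1.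
  have vt (c : R) t : t != s -> expval (pstate c s) t = expval (pstate 0 s) t.
    by move=> ts; rewrite !expval_pstate (negPf ts) !mulr0.
  apply: count_ge acc0 (acc1 _) _.
    by rewrite trnorm_pstateB ?ltcR //; case/andP: e01.
  have al0 : 0 < 3^-1 :> R by rewrite invr_gt0.
  exact: (@accProb_likelihood_bound R n T _ _ _ s e 3^-1 0 0 m [::] vT d0 dp dm
    (vs 0) (vs e) (vs (- e)) (fun t ts => conj (vt e t ts) (vt (- e) t ts)) e01 al0 (lexx 0)).
(* The null state does not depend on the string, so the counts [V s] all refer to one experiment and
   sum to [m]. *)
have mm (s t : {ffun 'I_n -> 'I_4}) : pstate (0 : R) s = pstate 0 t.
  by rewrite /pstate !scale0r.
have [s1 s1id] : exists s : {ffun 'I_n -> 'I_4}, s != pauli_id n.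
  exists [ffun => ord_max]; apply/eqP => /ffunP /(_ (Ordinal n1)).
  by rewrite !ffunE.
have d0 := density_pstate s1id z1.
have sumV : \sum_s V s = m%:R.
  rewrite -(sum_expCount m [::] vT d0); apply: eq_bigr => s _.
  by rewrite /V (mm s s1).
rewrite -sumV (bigD1 (pauli_id n)) //=.
have Vid : 0 <= V (pauli_id n) by rewrite /V (mm _ s1); apply: expCount_ge0.
have : \sum_(s | s != pauli_id n) (12 * eps ^+ 2)^-1 <= \sum_(s | s != pauli_id n) V s.
  exact: ler_sum.
rewrite sumr_const.
have -> : #|[pred s : {ffun 'I_n -> 'I_4} | s != pauli_id n]| = (4 ^ n - 1)%N.
  rewrite -card_pauli subn1 -(cardC1 (pauli_id n)).
  exact: eq_card.
rewrite -[_ *+ _]mulr_natl natrB ?expn_gt0 // natrX => H.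
have p4 : 4 <= 4 ^+ n :> R.
  by rewrite -[leLHS]expr1 ler_weXn2l // ler1n.
(* Since [4 <= 4 ^+ n], removing the identity string keeps at least three quarters of the strings,
   and [3 / 4 / 12 = 1 / 16]. *)
have : 16^-1 * 4 ^+ n / eps ^+ 2 <= (4 ^+ n - 1) * (12 * eps ^+ 2)^-1.
  have -> : (4 ^+ n - 1) * (12 * eps ^+ 2)^-1 = (4 ^+ n - 1) / 12 / eps ^+ 2.
    by field; rewrite gt_eqF.
  by rewrite ler_pM2r ?invr_gt0 //; lra.
by lra.
Qed.

Unset Implicit Arguments.

Theorem mainTheorem1 (R : realType) :
  exists (Cu cl : R), 0 < Cu /\ 0 < cl /\
  forall (n : nat) (eps : R), (1 <= n)%N -> 0 < eps <= 1 ->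
    (exists (m : nat) (T : tester R n), valid_tester T /\ solves eps m T /\
        m%:R <= Cu * (n%:R ^+ 4 * 4%:R ^+ n) / eps ^+ 2) /\
    (forall (m : nat) (T : tester R n), valid_tester T -> solves eps m T ->
        cl * 4%:R ^+ n / eps ^+ 2 <= m%:R).
Proof.
exists (3 * (432 * 128)), 16^-1; split; first by rewrite !mulr_gt0.
split; first by rewrite invr_gt0.
move=> n eps n1 heps; split; first exact: upper_bound.
by move=> m T; apply: lower_bound.
Qed.
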